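(* Let $n\ge1$ and $N\ge1$ be integers, and let $\delta,\varphi\in(0,\pi]$ satisfy $n\delta\leq\varphi$. Suppose that the complex numbers $z_1,\dots,z_N\in\mathbb U$ have the following two properties: (i) any open arc of $\mathbb U$ of length $\varphi$ contains at most $n$ of them; (ii) any open arc of $\mathbb U$ of length $\delta$ contains at most one of them. Then for any positive integer $k\leq2\pi/\varphi$, \[ |z_1+\cdots+z_N| \leq\frac{\sin((N-(k-1)n)\delta/2)}{\sin(\delta/2)}\cdot \frac{\sin(k\varphi/2)}{\sin(\varphi/2)} +\frac{\sin((kn-N)\delta/2)}{\sin(\delta/2)}\cdot \frac{\sin((k-1)\varphi/2)}{\sin(\varphi/2)}. \]
   Context: $\mathbb U=\{z\in\mathbb C:|z|=1\}$ is the unit circle. For $u,v\in\mathbb U$ the arc $(u,v)$ consists of the points passed when moving counter-clockwise from $u$ to $v$; its length is the angle swept. ''Contains $m$ of them'' counts indices $j$ with $z_j$ in the arc. *)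

(* Defs.v *)
From HB Require Import structures.
From mathcomp Require Import all_boot all_order all_algebra.
From mathcomp Require Import complex.
From mathcomp Require Import all_classical all_reals all_analysis.

Set Implicit Arguments.
Unset Strict Implicit.
Unset Printing Implicit Defensive.

Import Order.TTheory GRing.Theory Num.Theory.

Local Open Scope classical_set_scope.
Local Open Scope ring_scope.
Local Open Scope complex_scope.

Definition expi (R : realType) (t : R) : R[i] := (cos t +i* sin t)%C.

(* The open arc (u, v) with v = u * expi l: the points passed, endpoints
   excluded, when moving counter-clockwise from u through the angle l.  It is
   indexed by its initial point and its length. *)
Definition open_arc (R : realType) (u : R[i]) (l : R) : set R[i] :=
  [set u * expi t | t in `]0, l[].

(* Counts indices, so that repeated values of z are counted repeatedly. *)
Definition count_in (R : realType) (N : nat) (z : 'I_N -> R[i])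
    (A : set R[i]) : nat :=
  #|[pred j | z j \in A]|.

(* Main.v *)
(** Write the sum as a sum of cosines of angles measured from its direction, and
sort the angles: [theta (l+1) >= theta l + delta], [theta (l+n) >= theta l + phi].
Pushing every angle towards 0 as far as the gaps allow ([periodic_compression])
only increases the cosines and makes the sequence exactly [n]-periodic up to the
shift [phi].  Residue classes modulo [n] are then arithmetic progressions of step
[phi], summed by the Dirichlet kernel; if [N = q n + a] there are [a] classes with
[q+1] terms and [n-a] with [q] terms, and their centres are [delta]-separated, so
that the same argument with step [delta] bounds the sums over the centres.  This
is the claim for [k = q+1].

If [(q+1) phi > 2 pi], the kernel of the long classes is negative and the sum of
the cosines of their centres has to be bounded from below; the slack needed for
this is [B(q) - B(q+1)], where [B(k)] is the claimed bound, because only [k = q]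
is then admissible.  Finally
[B(k+1) - B(k)] has the sign of [k n - N], so these values of [k] minimise [B]. *)

Require Import Defs.
From HB Require Import structures.
From mathcomp Require Import all_boot all_order all_algebra.
From mathcomp Require Import complex.
From mathcomp Require Import all_classical all_reals all_analysis.
From Stdlib Require Import Lia.
From mathcomp Require Import zify ring lra.

Set Implicit Arguments.
Unset Strict Implicit.
Unset Printing Implicit Defensive.

Import Order.TTheory GRing.Theory Num.Theory.

Local Open Scope ring_scope.
Local Open Scope complex_scope.

(** * Trigonometric identities and inequalities for sines of multiple angles *)

Section Trigonometry.
Variable R : realType.
Implicit Types x y c h : R.

Lemma cos_sub x y : cos x - cos y = - (2 * sin ((x + y) / 2) * sin ((x - y) / 2)).
Proof.
have -> : cos x = cos ((x + y) / 2 + (x - y) / 2) by congr cos; field.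
have -> : cos y = cos ((x + y) / 2 - (x - y) / 2) by congr cos; field.
by rewrite cosD cosB; ring.
Qed.

Lemma dirichlet_cos h x k :
  sin (h / 2) * \sum_(i < k) cos (x + i%:R * h) =
  sin (k%:R * h / 2) * cos (x + (k%:R - 1) * h / 2).
Proof.
elim: k => [|k IH]; first by rewrite big_ord0 mulr0 !mul0r sin0 mul0r.
rewrite big_ord_recr /= mulrDr IH -(natr1 k).
have -> : (k%:R + 1) * h / 2 = k%:R * h / 2 + h / 2 :> R by field.
have -> : x + (k%:R - 1) * h / 2 = (x + k%:R * h / 2) - h / 2 by field.
have -> : x + k%:R * h = (x + k%:R * h / 2) + k%:R * h / 2 by field.
have -> : x + (k%:R + 1 - 1) * h / 2 = x + k%:R * h / 2 by field.
set v := x + _; set u := k%:R * h / 2.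
by rewrite cosB (cosD v u) (sinD u); ring.
Qed.

Lemma cos_le_norm x y : `|y| <= `|x| -> `|x| <= pi -> cos x <= cos y.
Proof.
move=> yx xpi; rewrite -(cos_norm x) -(cos_norm y).
move: (yx); rewrite le_eqVlt => /orP[/eqP->//|lt_yx].
by apply: ltW; rewrite ltr_cos // in_itv /= normr_ge0 ?(le_trans yx).
Qed.

Lemma cos_le_pi x y : 0 <= x -> x <= y -> y <= pi -> cos y <= cos x.
Proof.
move=> x0 xy ypi; have y0 : 0 <= y by exact: le_trans xy.
by apply: cos_le_norm; rewrite !ger0_norm.
Qed.

Lemma sin_le_norm x y : `|x| <= y -> y <= pi / 2 -> `|sin x| <= sin y.
Proof.
rewrite ler_norml => /andP[a b] c.
have [d0 d1] : - (pi / 2) <= x /\ x <= pi / 2 by split; lra.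
have y0 : 0 <= y by lra.
have m := ltr_sin (R := R).
have H : forall u v : R, - (pi / 2) <= u -> u <= v -> v <= pi / 2 -> sin u <= sin v.
  move=> u v u1 uv v1; move: uv; rewrite le_eqVlt => /orP[/eqP->//|uv].
  by apply/ltW; rewrite ltr_sin // in_itv /=; apply/andP; split; lra.
by rewrite ler_norml -sinN !H //; lra.
Qed.

(** A division-free form of [r sin x <= tan (r x)]. In the induction the addition formulas reproduce
    the previous case times [cos x]; the remaining terms have the right sign because
    [cos x <= 1]. *)
Lemma sin_natmul_ge (r : nat) x : 0 <= x -> r%:R * x <= pi / 2 ->
  r%:R * sin x * cos (r%:R * x) <= sin (r%:R * x).
Proof.
move=> x0; elim: r => [|r IH]; first by rewrite !mul0r sin0.
rewrite -(natr1 r) mulrDl mul1r => hr.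
have r0 : 0 <= r%:R * x by rewrite mulr_ge0.
have := IH ltac:(lra).
set t := r%:R * x in hr r0 *; set rr : R := r%:R.
have pi0 := pi_gt0 R.
have s1 : 0 <= sin x by apply: sin_ge0_pi; lra.
have s2 : 0 <= sin t by apply: sin_ge0_pi; lra.
have c1 : 0 <= cos x by apply: cos_ge0_pihalf; lra.
have c2 : 0 <= cos t by apply: cos_ge0_pihalf; lra.
have rr0 : 0 <= rr by [].
have c3 := cos_le1 x.
rewrite sinD cosD => H.
have h1 : rr * sin x * cos t * cos x <= sin t * cos x by exact: ler_wpM2r.
have h2 : 0 <= rr * sin x * (sin t * sin x) by rewrite !mulr_ge0.
have h3 : 0 <= sin x * (sin t * sin x) by rewrite !mulr_ge0.
have h4 : 0 <= sin x * cos t * (1 - cos x) by rewrite !mulr_ge0 // subr_ge0.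
lra.
Qed.

(** Follows from [sin_natmul_ge] at [x / 2] by writing both sines with the double angle formula; the
    range thereby grows from [pi / 2] to [pi]. *)
Lemma sin_natmul_ge_cos2 (r : nat) x : 0 <= x -> r%:R * x <= pi ->
  r%:R * sin x * cos (r%:R * x / 2) ^+ 2 <= sin (r%:R * x).
Proof.
move=> x0 hr.
have := @sin_natmul_ge r (x / 2) ltac:(lra) ltac:(lra).
rewrite mulrA.
have [->|rn] := posnP r; first by rewrite !mul0r sin0.
have hx : x <= pi.
  by apply: le_trans hr; rewrite ler_peMl // ler1n.
have -> : r%:R * x = r%:R * x / 2 + r%:R * x / 2 by field.
set t := r%:R * x / 2 in hr *.
have t0 : 0 <= t by rewrite /t; apply: mulr_ge0; [apply: mulr_ge0|].
have -> : (r%:R * x / 2 + r%:R * x / 2) / 2 = t by rewrite /t; field.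
rewrite sinD.
have -> : sin x = sin (x / 2 + x / 2) by congr sin; field.
rewrite sinD.
have s1 : 0 <= sin (x / 2) by apply: sin_ge0_pi; lra.
have c1 := cos_le1 (x / 2).
have c2 : 0 <= cos t.
  have pi0 := pi_gt0 R; have tpi : t <= pi / 2 by rewrite /t; lra.
  by apply: cos_ge0_pihalf; lra.
set rr : R := r%:R; have rr0 : 0 <= rr by [].
move=> H.
have h1 : rr * sin (x / 2) * cos t * cos t <= sin t * cos t by exact: ler_wpM2r.
have h2 : 0 <= rr * sin (x / 2) * (cos t * cos t) * (1 - cos (x / 2)).
  by rewrite !mulr_ge0 // subr_ge0.
lra.
Qed.

(** The quotient [sin ((n + 1) t) / sin (n t)] decreases in [t]: by the recurrence [e3] each
    quotient is [2 cos t] minus the inverse of the previous one. *)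
Lemma sin_natmul_ratioS (n : nat) x y : 0 <= y -> y <= x -> n%:R * x <= pi ->
  sin (n.+1%:R * x) * sin (n%:R * y) <= sin (n.+1%:R * y) * sin (n%:R * x).
Proof.
move=> y0 yx; elim: n => [|n IH]; first by rewrite !mul0r sin0 !mulr0.
have e3 z : sin (n.+2%:R * z) = 2 * cos z * sin (n.+1%:R * z) - sin (n%:R * z) :> R.
  have -> : n.+2%:R * z = n.+1%:R * z + z by rewrite -(natr1 n.+1); ring.
  have -> : n%:R * z = n.+1%:R * z - z by rewrite -(natr1 n); ring.
  by rewrite sinD sinB; ring.
rewrite !e3 => hn.
have n1 : 0 <= (n.+1%:R : R) by [].
have x1 : 0 <= n.+1%:R * x by apply: mulr_ge0 => //; lra.
have y1 : 0 <= n.+1%:R * y by apply: mulr_ge0.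
have yx1 : n.+1%:R * y <= n.+1%:R * x by exact: ler_wpM2l.
have xx : x <= n.+1%:R * x by rewrite ler_peMl ?ler1n //; lra.
have H := IH ltac:(move: hn; rewrite -(natr1 n); lra).
have sx : 0 <= sin (n.+1%:R * x) by apply: sin_ge0_pi; lra.
have sy : 0 <= sin (n.+1%:R * y) by apply: sin_ge0_pi; lra.
have cc : cos x <= cos y.
  by apply: cos_le_norm; rewrite !ger0_norm //; lra.
have := mulr_ge0 (mulr_ge0 sx sy) (ltac:(lra) : 0 <= cos y - cos x).
lra.
Qed.

(** The quotient [sin (n t) / sin (r t)] is a product of consecutive quotients as in
    [sin_natmul_ratioS], so it decreases as well. *)
Lemma sin_natmul_ratio (r n : nat) x y : (r <= n)%N -> 0 < y -> y <= x ->
  n%:R * x <= pi / 2 ->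
  sin (n%:R * x) * sin (r%:R * y) <= sin (n%:R * y) * sin (r%:R * x).
Proof.
move=> + y0 yx; elim: n => [|n IH].
  by rewrite leqn0 => /eqP-> _; rewrite !mul0r sin0 !mul0r.
rewrite leq_eqVlt => /orP[/eqP-> _|]; first by rewrite mulrC.
rewrite ltnS => rn hn.
have x0 : 0 <= x by lra.
have pi0 := pi_gt0 R.
have hn' : n%:R * x <= pi / 2 by move: hn; rewrite -(natr1 n); lra.
have H1 := IH rn hn'.
have H2 := @sin_natmul_ratioS n x y ltac:(lra) yx ltac:(lra).
have [n0|n0] := posnP n.
  by move: rn; rewrite n0 leqn0 => /eqP->; rewrite !mul0r sin0 !mulr0.
have nR : 0 < (n%:R : R) by rewrite ltr0n.
have nx : 0 < n%:R * x by apply: mulr_gt0 => //; lra.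
have ny : 0 < n%:R * y by apply: mulr_gt0.
have nyx : n%:R * y <= n%:R * x by apply: ler_wpM2l => //; exact: ltW.
have sx : 0 < sin (n%:R * x) by apply: sin_gt0_pi; lra.
have sy : 0 < sin (n%:R * y) by apply: sin_gt0_pi; lra.
have ry : 0 <= sin (r%:R * y).
  have rr : (r%:R : R) <= n%:R by rewrite ler_nat.
  have r0 : 0 <= (r%:R : R) by [].
  have h : r%:R * y <= n%:R * y by apply: ler_wpM2r => //; exact: ltW.
  have h0 : 0 <= r%:R * y by rewrite mulr_ge0 ?ler0n ?ltW.
  by apply: sin_ge0_pi; lra.
have n1 : 0 <= (n.+1%:R : R) by [].
have s1 : 0 <= sin (n.+1%:R * y).
  have h : n.+1%:R * y <= n.+1%:R * x by apply: ler_wpM2l.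
  have h0 : 0 <= n.+1%:R * y by rewrite mulr_ge0 ?ler0n ?ltW.
  by apply: sin_ge0_pi; lra.
rewrite -(ler_pM2l (mulr_gt0 sx sy)).
have := ler_wpM2r ry H2; move=> /(ler_wpM2l (ltW sx)).
have := ler_wpM2l (mulr_ge0 s1 (ltW sx)) H1.
lra.
Qed.

End Trigonometry.

(** * Compressing a separated sequence to an arithmetic progression *)

Section Compression.
Variable R : realType.
Implicit Types (x theta psi : nat -> R) (d phi c : R).

Lemma steps_ge d x (j i a : nat) :
  (forall i, (i.+1 < a)%N -> x i + d <= x i.+1) ->
  (j + i < a)%N -> x j + i%:R * d <= x (j + i)%N.
Proof.
move=> hx; elim: i => [|i IH]; first by rewrite addn0 mul0r addr0.
rewrite addnS => h; have := IH (ltnW h); have := hx _ h.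
rewrite -(natr1 i); lra.
Qed.

(** Sliding the points towards 0 until they form a progression of step [d] lowers no cosine, and
    [dirichlet_cos] sums the result. The bounds on the centre [c] record how far it can move; they
    later tie the centres of the short classes to those of the long ones. *)
Lemma chain_le d x (a : nat) : 0 < d -> (0 < a)%N -> a%:R * d <= 2 * pi ->
  (forall i, (i.+1 < a)%N -> x i + d <= x i.+1) ->
  (forall i, (i < a)%N -> `|x i| <= pi) ->
  exists c, [/\ x 0%N + (a%:R - 1) * d / 2 <= c,
     c <= x a.-1 - (a%:R - 1) * d / 2, `|c| <= pi &
     sin (d / 2) * \sum_(i < a) cos (x i) <= sin (a%:R * d / 2) * cos c].
Proof.
move=> d0 a0 ad hx hpi.
have mono j i : (j <= i)%N -> (i < a)%N -> x j + (i - j)%:R * d <= x i.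
  by move=> ji ia; have := @steps_ge d x j (i - j) a hx; rewrite subnKC //; apply.
have natB_d j i : (j <= i)%N -> (i - j)%:R * d = i%:R * d - j%:R * d.
  by move=> ji; rewrite natrB // mulrBl.
suff [w [w0 wa hw]] : exists w, [/\ x 0%N <= w, w <= x a.-1 - (a%:R - 1) * d &
    forall i, (i < a)%N -> `|w + i%:R * d| <= `|x i|].
  exists (w + (a%:R - 1) * d / 2).
  have wpi i : (i < a)%N -> `|w + i%:R * d| <= pi.
    by move=> ia; apply: le_trans (hw _ ia) (hpi _ ia).
  split; [lra | lra | |].
    have := wpi 0%N a0; have := wpi a.-1 ltac:(by rewrite prednK).
    have -> : (a.-1%:R : R) = a%:R - 1 by rewrite -{2}(prednK a0) -natr1 addrK.
    rewrite !ler_norml mul0r addr0; lra.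
  rewrite -dirichlet_cos; apply: ler_wpM2l.
    have a1 : (1 : R) <= a%:R by rewrite ler1n.
    have := mulr_ge0 (ltac:(lra) : 0 <= a%:R - 1 :> R) (ltW d0).
    by move=> ?; apply: sin_ge0_pi; lra.
  by apply: ler_sum => i _; apply: cos_le_norm; [exact: hw|exact: hpi].
have aE : (a.-1%:R : R) = a%:R - 1 by rewrite -{2}(prednK a0) -natr1 addrK.
have [xpos|] := ltrP 0 (x 0%N).
  exists (x 0%N); split=> // [|i ia].
    have := mono 0%N a.-1 isT; rewrite subn0 prednK // aE leqnn => /(_ isT); lra.
  have id0 : 0 <= i%:R * d by rewrite mulr_ge0 ?ler0n ?ltW.
  have := mono 0%N i isT ia; rewrite subn0 => h.
  by rewrite !ger0_norm; lra.
move=> x0.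
have [xneg|] := lerP (x a.-1) 0.
  exists (x a.-1 - (a%:R - 1) * d); split=> // [|i ia].
    have := mono 0%N a.-1 isT; rewrite subn0 prednK // aE leqnn => /(_ isT); lra.
  have := mono i a.-1; rewrite prednK // -ltnS prednK // ia leqnn => /(_ isT isT).
  rewrite natB_d; last by rewrite -ltnS prednK.
  have idp : i%:R * d <= (a%:R - 1) * d.
    by rewrite ler_pM2r // -aE ler_nat -ltnS prednK.
  by rewrite aE => h; rewrite !ler0_norm; lra.
move=> xa.
have ex : exists i, 0 < x i by exists a.-1.
case: (ex_minnP ex) => p xp pmin.
have pa : (p < a)%N by rewrite -(prednK a0) ltnS; exact: pmin.
have p0 : (0 < p)%N by case: p xp {pmin pa} => // /lt_geF; rewrite x0.
have xp1 : x p.-1 <= 0.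
  by rewrite leNgt; apply/negP => /pmin; rewrite -ltnS prednK // ltnn.
have pE : (p.-1%:R : R) = p%:R - 1 by rewrite -{2}(prednK p0) -natr1 addrK.
have p1a : (p.-1 < a)%N by apply: leq_ltn_trans pa; exact: leq_pred.
(* Here 0 separates [x p.-1] from [x p]. With first term [w], term [p.-1] of the progression is the
   maximum of [x p.-1] and [- d], and term [p] that of [x p.-1 + d] and 0, so both lie between 0 and
   the points they replace. *)
pose w := Num.max (x p.-1 - p.-1%:R * d) (- (p%:R * d)).
have wle c : (w <= c) = (x p.-1 - p.-1%:R * d <= c) && (- (p%:R * d) <= c).
  by rewrite /w ge_max.
have [w1 w2] : x p.-1 - p.-1%:R * d <= w /\ - (p%:R * d) <= w.
  by apply/andP; rewrite -wle.
have w3 : w <= - (p.-1%:R * d) by rewrite wle pE; apply/andP; split; lra.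
have w4 : w <= x p - p%:R * d.
  rewrite wle; apply/andP; split; last lra.
  have := hx p.-1; rewrite prednK // pE => /(_ pa); lra.
exists w; split.
- have := mono 0%N p.-1 isT p1a; rewrite subn0; lra.
- have := mono p a.-1; rewrite prednK // -ltnS prednK // pa leqnn => /(_ isT isT).
  rewrite natB_d; last by rewrite -ltnS prednK.
  rewrite aE; lra.
move=> i ia; have [ip|pi] := ltnP i p.
  have ip1 : (i <= p.-1)%N by rewrite -ltnS prednK.
  have := mono i p.-1 ip1 p1a; rewrite natB_d // => h.
  have idp : i%:R * d <= p.-1%:R * d by rewrite ler_pM2r // ler_nat.
  by rewrite !ler0_norm; lra.
have := mono p i pi ia; rewrite natB_d // => h.
have idp : p%:R * d <= i%:R * d by rewrite ler_pM2r // ler_nat.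
by rewrite !ger0_norm; lra.
Qed.

End Compression.

(** * Compressing to a sequence that is periodic up to a shift *)

Section PeriodicCompression.
Variable R : realType.

(** One window of [n] terms determines [psi]. It suffices that these terms lie between [theta] and 0
    and their translates by [phi] between 0 and [theta]: over [n] indices [theta] grows by at least
    [phi] and [psi] by exactly [phi], which carries the comparison outwards on both sides. *)
Lemma periodic_compression (n Q : nat) (d phi : R) (theta : nat -> R) :
  (0 < n)%N -> 0 < d -> n%:R * d <= phi ->
  (forall l, theta l + d <= theta l.+1) ->
  (forall l, theta l + phi <= theta (l + n)%N) ->
  theta (Q + n.-1)%N <= 0 -> 0 <= theta (Q + n)%N ->
  exists psi : nat -> R, [/\ forall l, psi l + d <= psi l.+1,
    forall l, psi (l + n)%N = psi l + phi &
    forall l, `|psi l| <= `|theta l|].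
Proof.
move=> n0 d0 nd hd hphi thQ thQn.
have nE : (n.-1%:R : R) = n%:R - 1 by rewrite -{2}(prednK n0) -natr1 addrK.
have stepd j i : theta j + i%:R * d <= theta (j + i)%N.
  by apply: (@steps_ge R d theta j i (j + i).+1) => // k _.
have stepphi j i : theta j + i%:R * phi <= theta (j + i * n)%N.
  elim: i => [|i IH]; first by rewrite mul0r addr0 mul0n addn0.
  have := hphi (j + i * n)%N.
  rewrite -addnA -mulSnr -(natr1 i); lra.
(* On the window [Q, Q + n) of nonpositive angles, [psi] is the least sequence above
   [theta] whose translate by [phi] stays above [t], a lower bound for [theta (Q + n)];
   [t] also keeps the wrap-around gap at least [d]. *)
pose t := Num.max 0 (theta (Q + n.-1)%N + d).
have tle c : (t <= c) = (0 <= c) && (theta (Q + n.-1)%N + d <= c).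
  by rewrite /t ge_max.
have [t0 t1] : 0 <= t /\ theta (Q + n.-1)%N + d <= t by apply/andP; rewrite -tle.
have td : t <= d by rewrite tle; apply/andP; split; lra.
have tQ : t <= theta (Q + n)%N.
  rewrite tle thQn /=; have := hd (Q + n.-1)%N.
  by rewrite -addnS prednK.
pose g m := Num.max (theta (Q + m)%N) (t - phi + m%:R * d).
have gle m c : (g m <= c) = (theta (Q + m)%N <= c) && (t - phi + m%:R * d <= c).
  by rewrite /g ge_max.
have gge m : theta (Q + m)%N <= g m /\ t - phi + m%:R * d <= g m.
  by apply/andP; rewrite -gle.
have gd m : g m + d <= g m.+1.
  have [] := gge m.+1; rewrite addnS -(natr1 m) => h1 h2.
  suff : g m <= g m.+1 - d by lra.
  rewrite gle; have := hd (Q + m)%N => h3; apply/andP; split; lra.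
have gwrap : g n.-1 + d <= g 0%N + phi.
  suff : g n.-1 <= g 0%N + phi - d by lra.
  have [] := gge 0%N; rewrite gle mul0r nE => h1 h2.
  apply/andP; split; lra.
have gneg m : (m < n)%N -> g m <= 0.
  move=> mn; have mR : m%:R * d <= n.-1%:R * d.
    by rewrite ler_pM2r // ler_nat -ltnS prednK.
  have := stepd (Q + m)%N (n.-1 - m)%N.
  have -> : (Q + m + (n.-1 - m) = Q + n.-1)%N.
    by rewrite -addnA subnKC // -ltnS prednK.
  have : 0 <= (n.-1 - m)%:R * d by rewrite mulr_ge0 ?ler0n ?ltW.
  move: mR; rewrite nE gle => h1 h2 h3; apply/andP; split; lra.
have gup m : g m + phi <= theta (Q + m + n)%N.
  suff : g m <= theta (Q + m + n)%N - phi by lra.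
  have := stepd (Q + n)%N m; rewrite addnAC => h1.
  have := hphi (Q + m)%N => h2.
  rewrite gle; apply/andP; split; lra.
have glow m : 0 <= g m + phi.
  have [_ h] := gge m; have : 0 <= m%:R * d by rewrite mulr_ge0 ?ler0n ?ltW.
  lra.
(* Extends [g] by [phi] per period; [gd] gives the gaps inside a period and [gwrap] the gap between
   consecutive ones. *)
pose G y := g (y %% n)%N + (y %/ n)%:R * phi.
have GS y : G y + d <= G y.+1.
  rewrite /G; have := ltn_pmod y n0; set m := (y %% n)%N => mn.
  have [mn1|] := ltnP m.+1 n.
    have -> : (y.+1 %% n = m.+1)%N by rewrite -addn1 -modnDml addn1 -/m modn_small.
    have -> : (y.+1 %/ n = y %/ n)%N.
      by rewrite {1}(divn_eq y n) -/m -addnS divnMDl // (divn_small mn1) addn0.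
    by have := gd m; lra.
  rewrite leq_eqVlt ltnNge mn orbF => /eqP nm.
  have mE : m = n.-1 by rewrite nm.
  have -> : (y.+1 %% n = 0)%N by rewrite -addn1 -modnDml addn1 -/m -nm modnn.
  have -> : (y.+1 %/ n = (y %/ n).+1)%N.
    by rewrite {1}(divn_eq y n) -addnS divnMDl // -/m -nm divnn n0 addn1.
  rewrite mE -natr1; have := gwrap; lra.
(* The aim is [psi (Q + m) = g m]. Since [l - Q] may be negative, [Q] periods are added to it,
   giving the index [l + Q (n - 1)], and [Q phi] is subtracted in return. *)
pose psi l := G (l + Q * n.-1)%N - Q%:R * phi.
have psiE l m i : (l + Q * n.-1 = i * n + m)%N -> (m < n)%N ->
    psi l = g m + i%:R * phi - Q%:R * phi.
  move=> e mn; rewrite /psi /G e modnMDl modn_small // divnMDl // divn_small //.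
  by rewrite addn0.
exists psi; split=> l.
- by rewrite /psi addSn; have := GS (l + Q * n.-1)%N; lra.
- by rewrite /psi /G addnAC modnDr divnDr // divnn n0 addn1 -natr1; ring.
have := divn_eq (l + Q * n.-1) n; set i := ((_ + _) %/ n)%N.
have := ltn_pmod (l + Q * n.-1) n0; set m := ((_ + _) %% n)%N => mn e.
rewrite (psiE _ _ _ e mn).
have eQ : (l + Q * n = i * n + (Q + m))%N.
  by rewrite -{1}(prednK n0) mulnS addnCA e addnCA.
(* Up to the window, [theta <= psi <= 0]; after it, [0 <= psi <= theta]. *)
have [iQ|Qi] := leqP i Q.
  have eQ' : (l + (Q - i) * n = Q + m)%N.
    apply/eqP; rewrite -(eqn_add2l (i * n)) -eQ addnCA -mulnDl subnKC //.
  have := stepphi l (Q - i)%N; rewrite eQ' natrB //.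
  have iR : (i%:R : R) <= Q%:R by rewrite ler_nat.
  have phi0 : 0 <= phi by apply: le_trans nd; rewrite mulr_ge0 ?ler0n ?ltW.
  have := mulr_ge0 (ltac:(lra) : 0 <= Q%:R - i%:R :> R) phi0.
  have [h1 _] := gge m; have h2 := gneg m mn => h3 h4.
  by rewrite !ler0_norm; lra.
have eQ' : (l = Q + m + n + (i - Q.+1) * n)%N.
  apply/eqP; rewrite -(eqn_add2r (Q * n)) eQ -(subnKC Qi) addnC.
  by apply/eqP; lia.
have := stepphi (Q + m + n)%N (i - Q.+1)%N; rewrite -eQ' natrB //.
have iR : (Q.+1%:R : R) <= i%:R by rewrite ler_nat.
have phi0 : 0 <= phi by apply: le_trans nd; rewrite mulr_ge0 ?ler0n ?ltW.
have := mulr_ge0 (ltac:(lra) : 0 <= i%:R - Q.+1%:R :> R) phi0.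
rewrite -(natr1 Q).
have h1 := gup m; have h2 := glow m => h3 h4.
by rewrite !ger0_norm; lra.
Qed.

End PeriodicCompression.

(** * Summation over residue classes *)

Section ChainSums.
Variable R : realType.
Implicit Types (x psi : nat -> R) (d phi rho e o tau : R).

Lemma sum_residues (V : nmodType) (F : nat -> V) (n q a : nat) : (a <= n)%N ->
  \sum_(l < q * n + a) F l =
  \sum_(j < a) \sum_(i < q.+1) F (j + i * n)%N +
  \sum_(j < n - a) \sum_(i < q) F (a + j + i * n)%N.
Proof.
move=> an; elim: q => [|q IH].
  rewrite mul0n add0n [X in _ + X]big1 ?addr0 => [|j _]; last by rewrite big_ord0.
  by apply: eq_bigr => j _; rewrite big_ord1 mul0n addn0.
have -> : (q.+1 * n + a = q * n + a + (n - a + a))%N.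
  by rewrite subnK // mulSn addnAC addnC addnAC -addnA.
rewrite [LHS]big_split_ord /= IH [X in _ + X = _]big_split_ord /=.
under [in RHS]eq_bigr do rewrite big_ord_recr /=.
under [X in _ = _ + X]eq_bigr do rewrite big_ord_recr /=.
rewrite !big_split /= -!addrA; congr (_ + _).
rewrite [RHS]addrCA; congr (_ + _); rewrite [RHS]addrC; congr (_ + _).
  by apply: eq_bigr => j _; congr F; rewrite -addnA addnC.
by apply: eq_bigr => j _; congr F; rewrite mulSn -{3}(subnK an); lia.
Qed.

Lemma sum_cos_residues phi psi (n q a : nat) : (a <= n)%N ->
  (forall l, psi (l + n)%N = psi l + phi) ->
  sin (phi / 2) * \sum_(l < q * n + a) cos (psi l) =
  sin (q.+1%:R * phi / 2) * \sum_(j < a) cos (psi j + q%:R * phi / 2) +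
  sin (q%:R * phi / 2) * \sum_(j < n - a) cos (psi (a + j)%N + (q%:R - 1) * phi / 2).
Proof.
move=> an hpsi.
have psiE l i : psi (l + i * n)%N = psi l + i%:R * phi.
  elim: i => [|i IH]; first by rewrite mul0n addn0 mul0r addr0.
  by rewrite mulSnr addnA hpsi IH -(natr1 i); ring.
rewrite (sum_residues (fun l => cos (psi l))) // mulrDr !mulr_sumr.
congr (_ + _); apply: eq_bigr => j _;
  under eq_bigr do rewrite psiE; rewrite dirichlet_cos //.
by rewrite -(natr1 q) addrK.
Qed.

(** Both kernels are nonnegative here, so upper bounds for the two sums over centres suffice;
    [chain_le] with [cos c <= 1] supplies them. Allowing [a = n] covers multiples of [n], where all
    classes are equally long. *)
Lemma sum_cos_periodic_le d phi psi (n q a : nat) :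
  0 < d -> 0 < phi -> n%:R * d <= phi -> phi <= pi -> (a <= n)%N ->
  q.+1%:R * phi <= 2 * pi ->
  (forall l, psi l + d <= psi l.+1) ->
  (forall l, psi (l + n)%N = psi l + phi) ->
  (forall l, (l < q * n + a)%N -> `|psi l| <= pi) ->
  sin (d / 2) * (sin (phi / 2) * \sum_(l < q * n + a) cos (psi l)) <=
  sin (a%:R * d / 2) * sin (q.+1%:R * phi / 2) +
  sin ((n - a)%:R * d / 2) * sin (q%:R * phi / 2).
Proof.
move=> d0 phi0 nd phipi an qphi hd hphi hpi.
have psiE l i : psi (l + i * n)%N = psi l + i%:R * phi.
  elim: i => [|i IH]; first by rewrite mul0n addn0 mul0r addr0.
  by rewrite mulSnr addnA hphi IH -(natr1 i); ring.
have q0 : 0 <= q%:R * phi by rewrite mulr_ge0 ?ler0n ?ltW.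
have qE : q.+1%:R * phi = q%:R * phi + phi by rewrite -(natr1 q); ring.
have pi0 := pi_gt0 R.
have b_le b x : (b <= n)%N -> (forall i, x i + d <= x i.+1) ->
    (forall i, (i < b)%N -> `|x i| <= pi) ->
    sin (d / 2) * \sum_(i < b) cos (x i) <= sin (b%:R * d / 2).
  move=> bn xd xpi; have [->|b0] := posnP b.
    by rewrite big_ord0 mulr0 mul0r mul0r sin0.
  have bd : b%:R * d <= n%:R * d by rewrite ler_pM2r // ler_nat.
  have bd0 : 0 <= b%:R * d by rewrite mulr_ge0 ?ler0n ?ltW.
  have [c [_ _ _ h]] := @chain_le R d x b d0 b0 ltac:(lra) (fun i _ => xd i) xpi.
  apply: le_trans h _; apply: ler_piMr (cos_le1 _).
  by apply: sin_ge0_pi; lra.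
(* A centre is the midpoint of the first and last angle of its class. *)
have mid l i : `|psi l| <= pi -> `|psi (l + i * n)%N| <= pi ->
    `|psi l + i%:R * phi / 2| <= pi.
  rewrite psiE !ler_norml; lra.
rewrite sum_cos_residues // mulrDr lerD //.
- rewrite mulrCA mulrC; apply: ler_wpM2r.
    by apply: sin_ge0_pi; lra.
  apply: (b_le _ (fun j => psi j + q%:R * phi / 2)) => // i => [|ia].
    by have := hd i; lra.
  by apply: mid; apply: hpi; lia.
(* For [q = 0] the short classes are empty and nothing controls their centres, but their kernel is
   [sin 0]. *)
- rewrite mulrCA mulrC; case: q q0 qE qphi hpi => [|q] q0 qE qphi hpi.
    by rewrite !mul0r sin0 !mulr0.
  apply: ler_wpM2r; first by apply: sin_ge0_pi; lra.
  have -> : (q.+1%:R - 1) = q%:R :> R by rewrite -(natr1 q) addrK.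
  apply: (b_le _ (fun j => psi (a + j)%N + q%:R * phi / 2)); first exact: leq_subr.
    by move=> i; rewrite addnS; have := hd (a + i)%N; lra.
  by move=> i ia; apply: mid; apply: hpi; rewrite mulSn; lia.
Qed.

(** Each [x i] lies between [x 0 + i d] and [x 0 + i d + tau]; the middles [y i] of these intervals
    form a progression with the same midpoint of end terms. By [cos_sub], a displacement of at most
    [tau / 2] costs at most [2 sin (rho / 2) sin (tau / 4)]. *)
Lemma chain_ge d rho tau x (r : nat) : 0 < d -> d <= pi -> (0 < r)%N -> rho <= pi ->
  (forall i, (i.+1 < r)%N -> x i + d <= x i.+1) ->
  (forall i, (i < r)%N -> `|x i| <= rho / 2) ->
  tau = x r.-1 - x 0%N - (r%:R - 1) * d ->
  sin (r%:R * d / 2) * cos ((x 0%N + x r.-1) / 2)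
    - 2 * (r%:R * sin (d / 2)) * sin (rho / 2) * sin (tau / 4)
  <= sin (d / 2) * \sum_(i < r) cos (x i).
Proof.
move=> d0 dpi r0 rhopi hd hrho tauE.
have rE : (r.-1%:R : R) = r%:R - 1 by rewrite -{2}(prednK r0) -natr1 addrK.
have pi0 := pi_gt0 R.
have h0 := hrho 0%N r0; have h1 := hrho r.-1 ltac:(by rewrite prednK).
have tau0 : 0 <= tau.
  have := @steps_ge R d x 0 r.-1 r hd; rewrite add0n prednK // rE => /(_ (leqnn _)).
  rewrite tauE; lra.
have r10 : 0 <= (r%:R - 1) * d.
  by rewrite -rE mulr_ge0 ?ler0n ?ltW.
have tau1 : tau <= rho by move: h0 h1; rewrite tauE !ler_norml; lra.
pose y i := x 0%N + tau / 2 + i%:R * d.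
have sumy : sin (d / 2) * \sum_(i < r) cos (y i) =
    sin (r%:R * d / 2) * cos ((x 0%N + x r.-1) / 2).
  by rewrite dirichlet_cos tauE; congr (_ * cos _); field.
have dpi0 : 0 <= sin (d / 2) by apply: sin_ge0_pi; lra.
rewrite -sumy lerBlDl -lerBlDr -mulrBr -sumrB.
have -> : 2 * (r%:R * sin (d / 2)) * sin (rho / 2) * sin (tau / 4) =
    sin (d / 2) * \sum_(i < r) (2 * sin (rho / 2) * sin (tau / 4)).
  by rewrite sumr_const card_ord -mulr_natl; ring.
apply: ler_wpM2l => //; apply: ler_sum => i _.
have ri : (i <= r.-1)%N by rewrite -ltnS prednK.
have xi0 : x 0%N + i%:R * d <= x i.
  by have := @steps_ge R d x 0 i r hd; rewrite add0n; apply.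
have xi1 : x i + (r.-1%:R - i%:R) * d <= x r.-1.
  have := @steps_ge R d x i (r.-1 - i) r hd.
  by rewrite subnKC // natrB // prednK //; apply.
have idr : i%:R * d <= (r%:R - 1) * d by rewrite ler_pM2r // -rE ler_nat.
have id0 : 0 <= i%:R * d by rewrite mulr_ge0 ?ler0n ?ltW.
have hi := hrho i (ltn_ord i).
move: xi1; rewrite rE => xi1.
have s1 : `|sin ((y i + x i) / 2)| <= sin (rho / 2).
  apply: sin_le_norm; last lra.
  by move: h0 h1 hi; rewrite /y tauE !ler_norml; lra.
have s2 : `|sin ((y i - x i) / 2)| <= sin (tau / 4).
  apply: sin_le_norm; last lra.
  by move: h0 h1 hi; rewrite /y tauE !ler_norml; lra.
rewrite cos_sub; apply: le_trans (ler_norm _) _.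
rewrite normrN !normrM ger0_norm //.
by rewrite -!mulrA ler_pM2l // ler_pM.
Qed.

End ChainSums.

(** * Estimates for the case of a negative kernel of the long classes *)

Section LargeN.
Variable R : realType.
Implicit Types (x psi : nat -> R) (d phi rho e o tau : R).

Lemma sin_add_le (x y : R) : 0 <= x + y <= pi ->
  sin x + sin y <= 2 * sin ((x + y) / 2).
Proof.
move=> xy.
have -> : sin x = sin ((x + y) / 2 + (x - y) / 2) by congr sin; field.
have -> : sin y = sin ((x + y) / 2 - (x - y) / 2) by congr sin; field.
rewrite sinD sinB.
have s0 : 0 <= sin ((x + y) / 2) by apply: sin_ge0_pi; lra.
have := mulr_ge0 s0 (ltac:(by rewrite subr_ge0 cos_le1) : 0 <= 1 - cos ((x - y) / 2)).
lra.
Qed.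

(** Expanded, the claim is [sin (phi / 2) sin (r d / 2) cos (rho / 2) <= sin (rho / 2) sin (n d / 2)
    cos (r d / 2)]. The sines compare by [sin_natmul_ratio] at [d / 2] and [x = phi / (2 n)], as
    [r x <= rho / 2]; the cosines compare because [r d <= rho]. *)
Lemma sin_sub_mul_le (r n : nat) d phi rho : (0 < r < n)%N ->
  0 < d -> n%:R * d <= phi -> phi <= pi -> rho <= phi ->
  r%:R * phi <= n%:R * rho ->
  sin ((phi - rho) / 2) * sin (r%:R * d / 2) <=
  sin (rho / 2) * (sin ((n%:R - r%:R) * d / 2) +
    sin (r%:R * d / 2) * (cos (n%:R * d / 2) - cos (phi / 2))).
Proof.
move=> /andP[r0 rn] d0 nd phipi rphi hr.
have nR : 0 < (n%:R : R) by rewrite ltr0n (leq_trans _ rn).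
have rR : 0 < (r%:R : R) by rewrite ltr0n.
have rnR : (r%:R : R) <= n%:R by rewrite ler_nat ltnW.
have pi0 := pi_gt0 R.
have rd0 : 0 < r%:R * d by rewrite mulr_gt0.
have nd0 : 0 < n%:R * d by rewrite mulr_gt0.
pose x := phi / (2 * n%:R).
have nx : n%:R * x = phi / 2 by rewrite /x; field; rewrite gt_eqF.
have xd : d / 2 <= x by rewrite -(ler_pM2l nR) nx; lra.
have rx : r%:R * x <= rho / 2 by rewrite -(ler_pM2l nR) mulrCA nx; lra.
have rdx : r%:R * (d / 2) <= r%:R * x by rewrite ler_pM2l.
have rnx : r%:R * x <= n%:R * x by apply: ler_wpM2r => //; lra.
have := @sin_natmul_ratio R r n x (d / 2) (ltnW rn) ltac:(lra) xd ltac:(lra).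
rewrite nx (mulrA r%:R d) (mulrA n%:R d) => h1.
have sr : sin (r%:R * x) <= sin (rho / 2).
  apply: le_trans (ler_norm _) _; apply: sin_le_norm; last lra.
  by rewrite ger0_norm; lra.
have sm : 0 <= sin (n%:R * d / 2) by apply: sin_ge0_pi; lra.
have srd : 0 <= sin (r%:R * d / 2) by apply: sin_ge0_pi; lra.
have srho : 0 <= sin (rho / 2) by apply: sin_ge0_pi; lra.
have sphi : 0 <= sin (phi / 2) by apply: sin_ge0_pi; lra.
have cc : cos (rho / 2) <= cos (r%:R * d / 2).
  by apply: cos_le_pi; lra.
have crho : 0 <= cos (rho / 2) by apply: cos_ge0_pihalf; lra.
have h2 := ler_wpM2l sm sr.
have h3 := ler_wpM2r crho (le_trans h1 h2).
have h4 := ler_wpM2l (mulr_ge0 sm srho) cc.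
rewrite (_ : (phi - rho) / 2 = phi / 2 - rho / 2); last by field.
rewrite (_ : (n%:R - r%:R) * d / 2 = n%:R * d / 2 - r%:R * d / 2); last by field.
rewrite !sinB; lra.
Qed.

Lemma sin_half_sub_le phi rho : 0 <= rho -> rho <= phi -> phi <= pi ->
  sin ((phi - rho) / 2) <=
  2 * sin (phi / 4) * cos (phi / 4) * cos (rho / 2).
Proof.
move=> rho0 rphi phipi; have pi0 := pi_gt0 R.
rewrite (_ : (phi - rho) / 2 = phi / 2 - rho / 2); last by field.
rewrite sinB.
have cphi0 : 0 <= cos (phi / 2) by apply: cos_ge0_pihalf; lra.
have srho0 : 0 <= sin (rho / 2) by apply: sin_ge0_pi; lra.
have -> : sin (phi / 2) = 2 * sin (phi / 4) * cos (phi / 4).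
  rewrite (_ : phi / 2 = phi / 4 + phi / 4); last by field.
  by rewrite sinD; ring.
have := mulr_ge0 cphi0 srho0; lra.
Qed.

Lemma cos_half_quarter rho : cos (rho / 2) = 2 * cos (rho / 4) ^+ 2 - 1.
Proof.
rewrite (_ : rho / 2 = rho / 4 + rho / 4); last by field.
by rewrite cosD; have := cos2Dsin2 (rho / 4); lra.
Qed.

(** With [C = cos (rho / 4)] one has [cos (rho / 2) = 2 C^2 - 1 <= C^4]. One factor [C^2] is
    absorbed by [sin_natmul_ge_cos2], the other remains on the right. *)
Lemma natmul_sin_cos_le (r : nat) d rho : 0 <= d -> r%:R * d <= rho -> rho <= pi ->
  r%:R * sin (d / 2) * cos (rho / 2) <= sin (r%:R * d / 2) * cos (rho / 4) ^+ 2.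
Proof.
move=> d0 rdrho rhopi; have pi0 := pi_gt0 R.
have [->|r0] := posnP r; first by rewrite !mul0r sin0 mul0r.
have rd0 : 0 <= r%:R * d by rewrite mulr_ge0.
have := @sin_natmul_ge_cos2 R r (d / 2) ltac:(lra) ltac:(lra).
rewrite !(mulrA r%:R d) => h.
have C0 : 0 <= cos (rho / 4) by apply: cos_ge0_pihalf; lra.
have dr : d <= r%:R * d by rewrite ler_peMl // ler1n.
have sd0 : 0 <= sin (d / 2) by apply: sin_ge0_pi; lra.
have rs0 : 0 <= r%:R * sin (d / 2) by rewrite mulr_ge0.
have Cc : cos (rho / 4) <= cos (r%:R * d / 2 / 2) by apply: cos_le_pi; lra.
set C := cos (rho / 4) in C0 Cc *.
have h1 : r%:R * sin (d / 2) * C ^+ 2 <= sin (r%:R * d / 2).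
  apply: le_trans h; apply: ler_wpM2l => //.
  by rewrite ler_sqr ?nnegrE // (le_trans C0).
have h2 : cos (rho / 2) <= C ^+ 2 * C ^+ 2.
  rewrite cos_half_quarter -/C; have := sqr_ge0 (C ^+ 2 - 1); rewrite sqrrB1; lra.
apply: le_trans (ler_wpM2l rs0 h2) _.
by rewrite mulrA; apply: ler_wpM2r => //; exact: sqr_ge0.
Qed.

(** The right-hand side is [2 sin ((phi + m) / 4) sin (2 u)] with [u = (x + y) / 2]. On the left,
    [sin x + sin y <= 2 sin u] by concavity, [cos (phi / 4) <= cos u] and
    [sin (phi / 4) <= sin ((phi + m) / 4)]. *)
Lemma sin_gap_le phi m (x y : R) : 0 <= x -> 0 <= y -> x + y = (phi - m) / 4 ->
  0 <= m -> phi <= pi ->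
  2 * sin (phi / 4) * cos (phi / 4) * (sin x + sin y) <= cos (m / 2) - cos (phi / 2).
Proof.
move=> x0 y0 xy m0 phipi; have pi0 := pi_gt0 R.
have s0 : 0 <= sin (phi / 4) by apply: sin_ge0_pi; lra.
have c0 : 0 <= cos (phi / 4) by apply: cos_ge0_pihalf; lra.
have := @sin_add_le x y; rewrite xy => /(_ ltac:(lra)).
set u := (phi - m) / 4 / 2 => h.
have cc : cos (phi / 4) <= cos u by apply: cos_le_pi; rewrite /u; lra.
have su : 0 <= sin u by apply: sin_ge0_pi; rewrite /u; lra.
have u2 : 0 <= sin (u + u) by apply: sin_ge0_pi; rewrite /u; lra.
have ss : sin (phi / 4) <= sin ((phi + m) / 4).
  apply: le_trans (ler_norm _) _; apply: sin_le_norm; last lra.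
  by rewrite ger0_norm; lra.
have -> : cos (m / 2) - cos (phi / 2) = 2 * sin ((phi + m) / 4) * sin (u + u).
  by rewrite /u cos_sub -mulrN -sinN; congr (2 * sin _ * sin _); field.
have h1 := ler_wpM2l (mulr_ge0 s0 c0) h.
have h2 := ler_wpM2l (mulr_ge0 s0 su) cc.
have h3 := ler_wpM2r u2 ss.
have sE : sin (u + u) = 2 * (sin u * cos u) by rewrite sinD; ring.
by move: h3; rewrite sE; lra.
Qed.

(** The witness is the cosine of whichever of [e] and [o] is nearer to 0. It exceeds [cos e] only if
    [|o| < |e|], and then [cos_sub] controls the excess. *)
Lemma cos_toward_zero rho e o (x : R) : rho <= pi -> x <= pi / 2 ->
  `|e| <= rho / 2 -> `|o| <= pi -> `|o - e| <= 2 * x ->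
  exists co, [/\ co <= 1, cos o <= co, co - cos e <= 2 * sin (rho / 2) * sin x &
    1 - co <= 1 - cos (rho / 2)].
Proof.
move=> rhopi xpi he hopi hoe; have pi0 := pi_gt0 R.
have rho0 := le_trans (normr_ge0 _) he; have x0 := le_trans (normr_ge0 _) hoe.
have A0 : 0 <= sin (rho / 2) by apply: sin_ge0_pi; lra.
have sx0 : 0 <= sin x by apply: sin_ge0_pi; lra.
have cle u : `|u| <= rho / 2 -> cos (rho / 2) <= cos u.
  by move=> hu; apply: cos_le_norm; rewrite (ger0_norm rho0) //; lra.
have [eo|oe] := lerP `|e| `|o|.
  exists (cos e); split; [exact: cos_le1|exact: cos_le_norm| |].
    by rewrite subrr !mulr_ge0.
  by rewrite lerD2l lerN2 cle.
have ho : `|o| <= rho / 2 by lra.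
exists (cos o); split; [exact: cos_le1|by []| |by rewrite lerD2l lerN2 cle].
have s1 : `|sin ((o + e) / 2)| <= sin (rho / 2).
  by apply: sin_le_norm; [move: he ho; rewrite !ler_norml|]; lra.
have s2 : `|sin ((o - e) / 2)| <= sin x.
  by apply: sin_le_norm => //; move: hoe; rewrite !ler_norml; lra.
rewrite cos_sub; apply: le_trans (ler_norm _) _.
rewrite normrN !normrM ger0_norm //.
by rewrite -!mulrA ler_pM2l // ler_pM.
Qed.

(* The case [q + 1 > 2 pi / phi] of the theorem: [rho = 2 pi - q phi], [e] is the
   midpoint of the centres of the long classes, [tau] the excess of their spread over
   that of an arithmetic progression, and [o] the centre of the short classes. *)
Lemma large_N_estimate (r n : nat) d phi rho e o tau : (0 < r < n)%N ->
  0 < d -> n%:R * d <= phi -> phi <= pi -> 0 < rho -> rho <= phi ->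
  r%:R * phi <= n%:R * rho -> 0 <= tau ->
  `|e| <= rho / 2 -> `|o| <= pi -> `|o - e| <= (phi - n%:R * d - tau) / 2 ->
  sin (rho / 2) * (sin ((n%:R - r%:R) * d / 2) * cos o)
  - sin ((phi - rho) / 2) * (sin (r%:R * d / 2) * cos e -
      2 * (r%:R * sin (d / 2)) * sin (rho / 2) * sin (tau / 4)) <=
  sin (rho / 2) * sin ((n%:R - r%:R) * d / 2) -
  sin ((phi - rho) / 2) * sin (r%:R * d / 2) +
  2 * (sin (rho / 2) * sin (r%:R * d / 2)
    * (cos (n%:R * d / 2) - cos (phi / 2))).
Proof.
move=> hrn d0 nd phipi rho0 rphi hr tau0 he hopi hoe.
have key := sin_sub_mul_le hrn d0 nd phipi rphi hr.
move: hrn => /andP[r0 rn].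
have nR : 0 < (n%:R : R) by rewrite ltr0n (leq_trans _ rn).
have rR : 0 < (r%:R : R) by rewrite ltr0n.
have rnR : (r%:R : R) <= n%:R by rewrite ler_nat ltnW.
have pi0 := pi_gt0 R.
have rd0 : 0 < r%:R * d by rewrite mulr_gt0.
have rdnd : r%:R * d <= n%:R * d by rewrite ler_pM2r.
have rdrho : r%:R * d <= rho.
  rewrite -(ler_pM2l nR); apply: le_trans hr.
  by rewrite mulrCA ler_pM2l.
set A := sin (rho / 2) in key *.
set B := sin ((phi - rho) / 2) in key *.
set Sr := sin (r%:R * d / 2) in key *.
set Sn := sin ((n%:R - r%:R) * d / 2) in key *.
set D := cos _ - cos _ in key *.
have A0 : 0 <= A by apply: sin_ge0_pi; lra.
have B0 : 0 <= B by apply: sin_ge0_pi; lra.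
have Sr0 : 0 <= Sr by apply: sin_ge0_pi; lra.
have Sn0 : 0 <= Sn.
  by apply: sin_ge0_pi; rewrite mulrBl; lra.
have nd0 : 0 < n%:R * d by rewrite mulr_gt0.
(* [X + tau / 4 = (phi - n d) / 4]: the offset of the short centres and the excess spread of the
   long ones share one gap, as [sin_gap_le] requires. *)
pose X := (phi - n%:R * d - tau) / 4.
have X0 : 0 <= X by have := le_trans (normr_ge0 _) hoe; rewrite /X; lra.
have X1 : X <= pi / 2 by rewrite /X; lra.
have sX0 : 0 <= sin X by apply: sin_ge0_pi; lra.
have sY0 : 0 <= sin (tau / 4).
  by apply: sin_ge0_pi; move: X0; rewrite /X; lra.
have sc0 : 0 <= 2 * sin (phi / 4) * cos (phi / 4).
  have : 0 <= sin (phi / 4) by apply: sin_ge0_pi; lra.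
  have : 0 <= cos (phi / 4) by apply: cos_ge0_pihalf; lra.
  by move=> ? ?; rewrite !mulr_ge0.
have sd0 : 0 <= sin (d / 2).
  have : d <= r%:R * d by rewrite ler_peMl ?ler1n // ltW.
  by move=> ?; apply: sin_ge0_pi; lra.
have B_le : B <= _ := sin_half_sub_le (ltW rho0) rphi phipi.
have rs_le := @natmul_sin_cos_le r d rho (ltW d0) rdrho ltac:(lra).
have gap := @sin_gap_le phi (n%:R * d) X (tau / 4) X0 ltac:(lra)
  ltac:(by rewrite /X; field) (ltW nd0) phipi.
have [co [co0 co1 co2 co3]] := @cos_toward_zero rho e o X ltac:(lra) X1 he hopi
  ltac:(by rewrite /X; lra).
rewrite -/A -/Sr -/D in rs_le gap co2.
have C21 : cos (rho / 2) <= cos (rho / 4) ^+ 2.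
  by have := cos_le1 (rho / 2); rewrite cos_half_quarter; lra.
rewrite cos_half_quarter in co3.
clear - A0 B0 Sr0 Sn0 sX0 sY0 sc0 sd0 rR B_le rs_le gap co0 co1 co2 co3 C21 key.
set C := cos (rho / 4) ^+ 2 in rs_le co3 C21.
have C0 : 0 <= C := sqr_ge0 _.
set sc := 2 * sin (phi / 4) * cos (phi / 4) in sc0 B_le gap.
set sX := sin X in sX0 gap co2; set sY := sin (tau / 4) in sY0 gap *.
set sd := sin (d / 2) in sd0 rs_le *.
have BC : B <= sc * C by apply: le_trans B_le _; exact: ler_wpM2l.
have BrC : B * (r%:R * sd) <= sc * (Sr * C).
  have rs0 : 0 <= r%:R * sd by rewrite mulr_ge0 // ltW.
  apply: le_trans (ler_wpM2r rs0 B_le) _.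
  by rewrite -mulrA; apply: ler_wpM2l => //; rewrite mulrC.
have D0 : 0 <= D by apply: le_trans gap; rewrite mulr_ge0 ?addr_ge0.
have ASr0 := mulr_ge0 A0 Sr0.
(* [k1] and [k2] replace [cos o] and [cos e] by [co]; by [k3], [k4] and [k5] both errors together
   are at most [2 A Sr C D]. By [k6] and [k7] the remaining [2 A Sr D (1 - C)] makes up for
   replacing [co] by 1. *)
have k1 := ler_wpM2l (mulr_ge0 A0 Sn0) co1.
have k2 := ler_wpM2l (mulr_ge0 B0 Sr0) co2.
have k3 := ler_wpM2r (mulr_ge0 ASr0 sX0) BC.
have k4 := ler_wpM2r (mulr_ge0 A0 sY0) BrC.
have k5 := ler_wpM2l (mulr_ge0 ASr0 C0) gap.
have co01 : 0 <= 1 - co by rewrite subr_ge0.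
have k6 := ler_wpM2r co01 key.
have k7 := ler_wpM2l (mulr_ge0 ASr0 D0) co3.
lra.
Qed.

End LargeN.

(** * The sum when the long kernel is not positive, and the claimed bound as a function of [k] *)

Section Bounds.
Variable R : realType.
Implicit Types (psi : nat -> R) (d phi : R).

(** The long kernel is [- sin ((phi - rho) / 2) <= 0], so the long centres are treated by [chain_ge]
    and the short ones by [chain_le]. The right-hand side is the claimed bound for [k = q] and
    [N = q n + r]. *)
Lemma sum_cos_periodic_large_le d phi psi (n q r : nat) :
  0 < d -> 0 < phi -> n%:R * d <= phi -> phi <= pi -> (0 < r < n)%N -> (0 < q)%N ->
  2 * pi <= q.+1%:R * phi ->
  r%:R * phi <= n%:R * (2 * pi - q%:R * phi) ->
  (forall l, psi l + d <= psi l.+1) ->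
  (forall l, psi (l + n)%N = psi l + phi) ->
  (forall l, (l < q * n + r)%N -> `|psi l| <= pi) ->
  sin (d / 2) * (sin (phi / 2) * \sum_(l < q * n + r) cos (psi l)) <=
  sin ((n%:R + r%:R) * d / 2) * sin (q%:R * phi / 2)
  - sin (r%:R * d / 2) * sin ((q%:R - 1) * phi / 2).
Proof.
move=> d0 phi0 nd phipi hrn q0 qphi hr hd hphi hpi.
have [r0 rn] := andP hrn.
have y_idx2 j : (j < n - r)%N -> (r + j + q.-1 * n < q * n + r)%N.
  rewrite -{2}(prednK q0) mulSn ltn_subRL => jr.
  by rewrite addnC (addnC n) -addnA ltn_add2l (leq_trans jr) // leq_addr.
have y_idx1 j : (j < n - r)%N -> (r + j < q * n + r)%N.
  by move=> /y_idx2; apply: leq_ltn_trans; exact: leq_addr.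
have psiE l i : psi (l + i * n)%N = psi l + i%:R * phi.
  elim: i => [|i IH]; first by rewrite mul0n addn0 mul0r addr0.
  by rewrite mulSnr addnA hphi IH -(natr1 i); ring.
have pi0 := pi_gt0 R.
have qE : q.+1%:R * phi = q%:R * phi + phi by rewrite -(natr1 q); ring.
have q1E : (q.-1%:R : R) = q%:R - 1 by rewrite -{2}(prednK q0) -natr1 addrK.
have nR : 0 < (n%:R : R) by rewrite ltr0n (leq_trans _ rn).
have rR : 0 < (r%:R : R) by rewrite ltr0n.
have nd0 : 0 < n%:R * d by rewrite mulr_gt0.
have dn : d <= n%:R * d by rewrite ler_peMl ?ler1n ?(leq_trans _ rn) // ltW.
pose rho := 2 * pi - q%:R * phi.
have rho0 : 0 < rho by rewrite -(pmulr_rgt0 _ nR); apply: lt_le_trans hr; rewrite mulr_gt0.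
have rphi : rho <= phi by rewrite /rho; lra.
pose x j := psi j + q%:R * phi / 2.
pose y j := psi (r + j)%N + (q%:R - 1) * phi / 2.
(* The end angles of a long class are [q phi] apart within [[- pi, pi]], which confines their
   midpoint. *)
have x_rho j : (j < r)%N -> `|x j| <= rho / 2.
  move=> jr; have := hpi j ltac:(by rewrite ltn_addl).
  have := hpi (j + q * n)%N ltac:(by rewrite addnC ltn_add2l).
  by rewrite psiE !ler_norml /x /rho; lra.
have y_pi j : (j < n - r)%N -> `|y j| <= pi.
  move=> jr; have := hpi _ (y_idx1 j jr); have := hpi _ (y_idx2 j jr).
  by rewrite psiE q1E !ler_norml /y; lra.
have xd j : x j + d <= x j.+1 by rewrite /x; have := hd j; lra.
have yd j : y j + d <= y j.+1.
  by rewrite /y addnS; have := hd (r + j)%N; lra.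
have nr0 : (0 < n - r)%N by rewrite subn_gt0.
have nrE : ((n - r)%:R : R) = n%:R - r%:R by rewrite natrB // ltnW.
have rd0 : 0 < r%:R * d by rewrite mulr_gt0.
have [c [c1 c2 cpi sum_y]] := @chain_le R d y (n - r) d0 nr0
  ltac:(by rewrite nrE; lra) (fun j _ => yd j) y_pi.
have sum_x := @chain_ge R d rho _ x r d0 ltac:(lra) r0 ltac:(lra)
  (fun j _ => xd j) x_rho erefl.
set tau := x r.-1 - x 0%N - (r%:R - 1) * d in sum_x.
have tau0 : 0 <= tau.
  have := @steps_ge R d x 0 r.-1 r (fun j _ => xd j).
  rewrite add0n prednK // => /(_ (leqnn _)).
  have -> : (r.-1%:R : R) = r%:R - 1 by rewrite -{2}(prednK r0) -natr1 addrK.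
  by rewrite /tau; lra.
(* The steps of [psi] from [r.-1] to [r] and from [n.-1] to [n] keep the short centres between
   [x r.-1 - phi / 2] and [x 0 + phi / 2], at distance at least [d] from both. *)
have hy0 : x r.-1 - phi / 2 + d <= y 0%N.
  by have := hd r.-1; rewrite prednK // /x /y addn0; lra.
have hy1 : y (n - r).-1 <= x 0%N + phi / 2 - d.
  have := hd (r + (n - r).-1)%N; rewrite -addnS prednK // subnKC; last exact: ltnW.
  have := hphi 0%N; rewrite add0n /x /y; lra.
have e_rho : `|(x 0%N + x r.-1) / 2| <= rho / 2.
  have := x_rho 0%N r0; have := x_rho r.-1 ltac:(by rewrite prednK).
  by rewrite !ler_norml; lra.
have ce : `|c - (x 0%N + x r.-1) / 2| <= (phi - n%:R * d - tau) / 2.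
  by move: c1 c2; rewrite nrE ler_norml /tau; lra.
have est := large_N_estimate hrn d0 nd phipi rho0 rphi hr tau0 e_rho cpi ce.
have A0 : 0 <= sin (rho / 2) by apply: sin_ge0_pi; lra.
have B0 : 0 <= sin ((phi - rho) / 2) by apply: sin_ge0_pi; lra.
have ex : sin (q.+1%:R * phi / 2) = - sin ((phi - rho) / 2).
  by rewrite -(sinDpi ((phi - rho) / 2)); congr sin; rewrite /rho; lra.
have ey : sin (q%:R * phi / 2) = sin (rho / 2).
  have -> : q%:R * phi / 2 = - (rho / 2) + pi by rewrite /rho; field.
  by rewrite sinDpi sinN opprK.
have ez : sin ((q%:R - 1) * phi / 2) = sin (rho / 2 + phi / 2).
  have -> : (q%:R - 1) * phi / 2 = - (rho / 2 + phi / 2) + pi by rewrite /rho; field.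
  by rewrite sinDpi sinN opprK.
rewrite sum_cos_residues ?(ltnW rn) // ex ey ez.
have hx := ler_wpM2l B0 sum_x; have hy := ler_wpM2l A0 sum_y.
move: est hy; rewrite nrE => est hy.
(* The left-hand side is the bound for [k = q], the right-hand side that for [k = q + 1] plus the
   slack between the two. *)
have -> : sin ((n%:R + r%:R) * d / 2) * sin (rho / 2)
  - sin (r%:R * d / 2) * sin (rho / 2 + phi / 2) =
  sin (rho / 2) * sin ((n%:R - r%:R) * d / 2) -
  sin ((phi - rho) / 2) * sin (r%:R * d / 2) +
  2 * (sin (rho / 2) * sin (r%:R * d / 2)
    * (cos (n%:R * d / 2) - cos (phi / 2))).
  have -> : (n%:R + r%:R) * d / 2 = n%:R * d / 2 + r%:R * d / 2 by field.
  have -> : (n%:R - r%:R) * d / 2 = n%:R * d / 2 - r%:R * d / 2 by field.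
  have -> : (phi - rho) / 2 = phi / 2 - rho / 2 by field.
  by rewrite !sinD !sinN !cosN; ring.
apply: le_trans est; rewrite mulrDr.
move: hx hy; rewrite /x /y.
set S1 := \sum_(j < r) _; set S2 := \sum_(j < n - r) _.
clear; lra.
Qed.

(* The bound of the theorem multiplied by [sin (d / 2) * sin (phi / 2)]. *)
Definition arc_bound (n N : nat) d phi (k : nat) : R :=
  sin ((N%:R - (k%:R - 1) * n%:R) * d / 2) * sin (k%:R * phi / 2) +
  sin ((k%:R * n%:R - N%:R) * d / 2) * sin ((k%:R - 1) * phi / 2).

(** As [k%:R - 1] is a real subtraction, the identity also covers [k = 0], where the induction of
    [arc_bound_decr] starts. *)
Lemma arc_boundS (n N : nat) d phi (k : nat) :
  arc_bound n N d phi k.+1 - arc_bound n N d phi k =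
  2 * (sin (k%:R * phi / 2) * sin ((k%:R * n%:R - N%:R) * d / 2)
    * (cos (n%:R * d / 2) - cos (phi / 2))).
Proof.
rewrite /arc_bound -!(natr1 k).
pose u := (k%:R * n%:R - N%:R) * d / 2; pose v := n%:R * d / 2.
pose w := k%:R * phi / 2; pose z := phi / 2.
have -> : (N%:R - (k%:R + 1 - 1) * n%:R) * d / 2 = - u by rewrite /u; field.
have -> : (k%:R + 1) * phi / 2 = w + z by rewrite /w /z; field.
have -> : ((k%:R + 1) * n%:R - N%:R) * d / 2 = u + v by rewrite /u /v; field.
have -> : (k%:R + 1 - 1) * phi / 2 = w by rewrite /w; field.
have -> : (N%:R - (k%:R - 1) * n%:R) * d / 2 = v - u by rewrite /u /v; field.
have -> : (k%:R - 1) * phi / 2 = w - z by rewrite /w /z; field.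
rewrite -/u -/v -/w -/z !sinD !sinN !cosN; ring.
Qed.

(** Every increment from [k] on is nonnegative: [j n d <= j phi <= 2 pi] keeps both sine arguments
    in [arc_boundS] within [[0, pi]]. *)
Lemma arc_bound_incr (n N k k' : nat) d phi :
  0 <= d -> n%:R * d <= phi -> phi <= pi -> k'%:R * phi <= 2 * pi ->
  (N <= k * n)%N -> (k <= k')%N ->
  arc_bound n N d phi k <= arc_bound n N d phi k'.
Proof.
move=> d0 nd phipi; elim: k' => [|j IH] jphi hN.
  by rewrite leqn0 => /eqP ->.
rewrite leq_eqVlt => /orP[/eqP->//|]; rewrite ltnS => kj.
have nd0 : 0 <= n%:R * d by rewrite mulr_ge0.
have jE : j.+1%:R * phi = j%:R * phi + phi by rewrite -(natr1 j); ring.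
have jphi' : j%:R * phi <= 2 * pi by lra.
have j0 : 0 <= j%:R * phi by rewrite mulr_ge0 ?ler0n //; lra.
apply: (le_trans (IH jphi' hN kj)); rewrite -subr_ge0 arc_boundS.
have pi0 := pi_gt0 R.
have s1 : 0 <= sin (j%:R * phi / 2) by apply: sin_ge0_pi; lra.
have NR : (N%:R : R) <= j%:R * n%:R.
  by rewrite -natrM ler_nat (leq_trans hN) // leq_mul2r kj orbT.
have s2 : 0 <= sin ((j%:R * n%:R - N%:R) * d / 2).
  have h1 : 0 <= (j%:R * n%:R - N%:R) * d by rewrite mulr_ge0 // subr_ge0.
  have h2 : j%:R * (n%:R * d) <= j%:R * phi by rewrite ler_wpM2l.
  have h3 : 0 <= N%:R * d by rewrite mulr_ge0.
  by apply: sin_ge0_pi; lra.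
have s3 : 0 <= cos (n%:R * d / 2) - cos (phi / 2).
  by rewrite subr_ge0; apply: cos_le_pi; lra.
by rewrite !mulr_ge0.
Qed.

(** Here [N d <= 2 pi] keeps the sine arguments in range. The last increment involves
    [sin (k' phi / 2)] only, so [k' phi <= 2 pi] suffices to reach [k'.+1]. *)
Lemma arc_bound_decr (n N k k' : nat) d phi :
  0 <= d -> n%:R * d <= phi -> phi <= pi -> N%:R * d <= 2 * pi ->
  k'%:R * phi <= 2 * pi -> (k' * n <= N)%N -> (k <= k'.+1)%N ->
  arc_bound n N d phi k'.+1 <= arc_bound n N d phi k.
Proof.
move=> d0 nd phipi Nd; elim: k' => [|j IH] jphi hN.
  rewrite leq_eqVlt => /orP[/eqP->//|]; rewrite ltnS leqn0 => /eqP->.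
  by rewrite -subr_le0 arc_boundS !mul0r sin0 !mul0r mulr0.
rewrite leq_eqVlt => /orP[/eqP->//|]; rewrite ltnS => kj.
have nd0 : 0 <= n%:R * d by rewrite mulr_ge0.
have jE : j.+1%:R * phi = j%:R * phi + phi by rewrite -(natr1 j); ring.
have jphi' : j%:R * phi <= 2 * pi by lra.
have j0 : 0 <= j%:R * phi by rewrite mulr_ge0 ?ler0n //; lra.
have hN' : (j * n <= N)%N by rewrite (leq_trans _ hN) // leq_mul2r leqnSn orbT.
apply: (le_trans _ (IH jphi' hN' kj)); rewrite -subr_le0 arc_boundS.
have pi0 := pi_gt0 R.
have s1 : 0 <= sin (j.+1%:R * phi / 2) by apply: sin_ge0_pi; lra.
have NR : j.+1%:R * n%:R <= (N%:R : R) by rewrite -natrM ler_nat.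
have s2 : 0 <= sin ((N%:R - j.+1%:R * n%:R) * d / 2).
  have h1 : 0 <= (N%:R - j.+1%:R * n%:R) * d by rewrite mulr_ge0 // subr_ge0.
  have h2 : 0 <= j.+1%:R * (n%:R * d) by rewrite mulr_ge0.
  by apply: sin_ge0_pi; lra.
have s3 : 0 <= cos (n%:R * d / 2) - cos (phi / 2).
  by rewrite subr_ge0; apply: cos_le_pi; lra.
have -> : (j.+1%:R * n%:R - N%:R) * d / 2 = - ((N%:R - j.+1%:R * n%:R) * d / 2) by field.
rewrite sinN mulrN mulNr mulrN oppr_le0.
by rewrite !mulr_ge0.
Qed.

End Bounds.

(** * From separated angles to the bound on the sum of cosines *)

Section Angles.
Variable R : realType.

(** The gap hypotheses are guarded because counting forces a gap over [m] indices only when the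
    [m + 1] points involved have distinct indices, that is for [m < N]. *)
Lemma sum_cos_angles_le (n N k : nat) (d phi : R) (theta : nat -> R) :
  (0 < n)%N -> (0 < N)%N -> 0 < d -> 0 < phi -> phi <= pi -> n%:R * d <= phi ->
  (0 < k)%N -> k%:R * phi <= 2 * pi ->
  (forall l, theta (l + N)%N = theta l + 2 * pi) ->
  (forall l, theta l <= theta l.+1) ->
  (forall l, (l < N)%N -> `|theta l| <= pi) ->
  ((1 < N)%N -> forall l, theta l + d <= theta l.+1) ->
  ((n < N)%N -> forall l, theta l + phi <= theta (l + n)%N) ->
  sin (d / 2) * (sin (phi / 2) * \sum_(l < N) cos (theta l)) <=
  arc_bound n N d phi k.
Proof.
move=> n0 N0 d0 phi0 phipi nd k0 kphi per mono hpi hd hphi.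
have pi0 := pi_gt0 R.
have nR : 0 < (n%:R : R) by rewrite ltr0n.
have sphi : 0 <= sin (phi / 2) by apply: sin_ge0_pi; lra.
(* For [N <= n] only the gaps [d] are at hand; a single progression gives the bound for [k = 1], the
   least one in this case. *)
have [Nn|nN] := leqP N n.
  have Nd : N%:R * d <= n%:R * d by rewrite ler_pM2r // ler_nat.
  have hd' i : (i.+1 < N)%N -> theta i + d <= theta i.+1.
    by move=> iN; apply: hd; apply: leq_ltn_trans iN.
  have [c [_ _ _ h]] := @chain_le R d theta N d0 N0 ltac:(lra) hd' hpi.
  have Nd0 : 0 <= N%:R * d by rewrite mulr_ge0 // ltW.
  have sN : 0 <= sin (N%:R * d / 2) by apply: sin_ge0_pi; lra.
  apply: (@le_trans _ _ (arc_bound n N d phi 1)); last first.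
    by apply: arc_bound_incr; rewrite ?mul1n // ltW.
  rewrite /arc_bound subrr !mul0r subr0 sin0 mulr0 addr0 mul1r.
  rewrite mulrCA mulrC; apply: ler_wpM2r => //; apply: le_trans h _.
  by apply: ler_piMr (cos_le1 _).
have {}hphi := hphi nN.
have {}hd := hd (leq_ltn_trans n0 nN).
have perM l i : theta (l + N * i)%N = theta l + i%:R * (2 * pi).
  elim: i => [|i IH]; first by rewrite muln0 addn0 mul0r addr0.
  by rewrite mulnSr addnA per IH -(natr1 i); ring.
(* [N] steps of [n] indices each make exactly [n] full turns. *)
have Nphi : N%:R * phi <= n%:R * (2 * pi).
  have h i : theta 0%N + i%:R * phi <= theta (i * n)%N.
    elim: i => [|i IH]; first by rewrite mul0r addr0.
    by rewrite mulSnr; have := hphi (i * n)%N; rewrite -(natr1 i); lra.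
  by have := h N; have := perM 0%N n; rewrite add0n => ->; lra.
have Nd : N%:R * d <= 2 * pi.
  rewrite -(ler_pM2l nR); apply: le_trans Nphi.
  by rewrite mulrCA; apply: ler_wpM2l.
have monoW i j : (i <= j)%N -> theta i <= theta j.
  by move=> ij; rewrite -(subnK ij); elim: (j - i)%N => // m /le_trans; apply; exact: mono.
(* Going back [n] turns puts the given angles at the indices from [N n] on. The first positive index
   [P] is then at least [n], so the window starting at [P - n] has natural indices. *)
pose th l := theta l - n%:R * (2 * pi).
have exP : exists i, 0 < th i.
  exists (0 + N * n.+1)%N; rewrite /th perM -(natr1 n).
  by have := hpi 0%N N0; rewrite ler_norml; lra.
case: (ex_minnP exP) => P thP minP.
have PN : (N * n <= P)%N.
  rewrite leqNgt; apply/negP => PNn.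
  have Nn0 : (0 < N * n)%N by rewrite muln_gt0 N0.
  have : theta P <= theta (N * n).-1 by apply: monoW; rewrite -ltnS prednK.
  have -> : (N * n).-1 = (N.-1 + N * n.-1)%N.
    by rewrite -{1}(prednK n0) mulnS -{1}(prednK N0) addSn.
  rewrite perM.
  have -> : (n.-1%:R : R) = n%:R - 1 by rewrite -{2}(prednK n0) -natr1 addrK.
  have := hpi N.-1; rewrite prednK // leqnn => /(_ isT).
  by move: thP; rewrite /th ler_norml; lra.
have nP : (n <= P)%N by apply: leq_trans PN; rewrite leq_pmull.
have [psi0 [psi0d psi0n psi0th]] := @periodic_compression R n (P - n) d phi th n0 d0 nd
  ltac:(by move=> l; rewrite /th; have := hd l; lra)
  ltac:(by move=> l; rewrite /th; have := hphi l; lra)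
  ltac:(rewrite leNgt; apply/negP => /minP; rewrite leqNgt;
        by rewrite -[X in (_ < X)%N](subnK nP) ltn_add2l prednK // leqnn)
  ltac:(by rewrite subnK // ltW).
pose psi l := psi0 (l + N * n)%N.
have psid l : psi l + d <= psi l.+1 by rewrite /psi addSn.
have psin l : psi (l + n)%N = psi l + phi by rewrite /psi addnAC.
have psith l : `|psi l| <= `|theta l|.
  by have := psi0th (l + N * n)%N; rewrite /th perM addrK.
have psipi l : (l < N)%N -> `|psi l| <= pi.
  by move=> lN; apply: le_trans (psith l) (hpi l lN).
have sd : 0 <= sin (d / 2).
  have : d <= n%:R * d by rewrite ler_peMl ?ler1n // ltW.
  by move=> ?; apply: sin_ge0_pi; lra.
apply: (@le_trans _ _ (sin (d / 2) * (sin (phi / 2) * \sum_(l < N) cos (psi l)))).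
  do 2![apply: ler_wpM2l => //]; apply: ler_sum => i _.
  by apply: cos_le_norm; [exact: psith|exact: hpi].
pose q := (N %/ n)%N; pose a := (N %% n)%N.
have NE : N = (q * n + a)%N := divn_eq N n.
have an : (a < n)%N := ltn_pmod N n0.
have q0 : (0 < q)%N by rewrite divn_gt0 // ltnW.
have NR : (N%:R : R) = q%:R * n%:R + a%:R by rewrite {1}NE natrD natrM.
have qphi : q%:R * phi <= 2 * pi.
  rewrite -(ler_pM2l nR); apply: le_trans Nphi.
  rewrite NR; have : 0 <= a%:R * phi by rewrite mulr_ge0 // ltW.
  lra.
have qE : q.+1%:R * phi = q%:R * phi + phi by rewrite -(natr1 q); ring.
have qnN : (q * n <= N)%N by rewrite {1}NE leq_addr.
(* The bound is first proved for [q + 1] if that is admissible and for [q] otherwise; monotonicity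
   in [k] then reaches the given value. *)
have [q1phi|q1phi] := lerP (q.+1%:R * phi) (2 * pi).
  have h := @sum_cos_periodic_le R d phi psi n q a d0 phi0 nd phipi (ltnW an) q1phi
    psid psin ltac:(by move=> l; rewrite -NE; exact: psipi).
  apply: (@le_trans _ _ (arc_bound n N d phi q.+1)).
    rewrite -NE in h; apply: le_trans h _.
    rewrite /arc_bound natrB ?(ltnW an) // NR -(natr1 q) le_eqVlt; apply/orP; left.
    by apply/eqP; congr (sin _ * sin _ + sin _ * sin _); field.
  have [kq|kq] := leqP k q.+1.
    by apply: arc_bound_decr => //; exact: ltW.
  apply: arc_bound_incr => //; [exact: ltW| |exact: ltnW].
  by rewrite {1}NE mulSn addnC leq_add2r ltnW.
have kq : (k <= q)%N.
  rewrite -ltnS -(ltr_nat R) -(ltr_pM2r phi0); exact: le_lt_trans q1phi.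
apply: (@le_trans _ _ (arc_bound n N d phi q)); last first.
  rewrite -(prednK q0); apply: arc_bound_decr => //.
  - exact: ltW.
  - by apply: le_trans qphi; rewrite ler_pM2r // ler_nat leq_pred.
  - by apply: leq_trans qnN; rewrite leq_mul2r leq_pred orbT.
  - by rewrite prednK.
have q1E : (q.-1%:R : R) = q%:R - 1 by rewrite -{2}(prednK q0) -natr1 addrK.
(* If [n] divides [N], all classes have [q] terms and count as [n] long classes for [q - 1]; their
   kernel is nonnegative as [q phi <= 2 pi]. *)
have [a0|a0] := posnP a.
  have NE' : N = (q.-1 * n + n)%N by rewrite {1}NE a0 addn0 -mulSnr prednK.
  have := @sum_cos_periodic_le R d phi psi n q.-1 n d0 phi0 nd phipi (leqnn n)
    ltac:(by rewrite prednK) psid psin ltac:(by move=> l; rewrite -NE'; exact: psipi).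
  rewrite -NE' prednK // subnn mul0r mul0r sin0 mul0r addr0 => h.
  apply: le_trans h _; rewrite /arc_bound NR a0 addr0 subrr !mul0r sin0 mul0r addr0.
  by rewrite le_eqVlt; apply/orP; left; apply/eqP; congr (sin _ * sin _); field.
have := @sum_cos_periodic_large_le R d phi psi n q a d0 phi0 nd phipi
  ltac:(by rewrite a0) q0 (ltW q1phi)
  ltac:(by rewrite mulrBr; move: Nphi; rewrite NR; lra) psid psin
  ltac:(by move=> l; rewrite -NE; exact: psipi).
rewrite -NE => h; apply: le_trans h _; rewrite /arc_bound NR.
rewrite le_eqVlt; apply/orP; left; apply/eqP.
by rewrite -mulNr -sinN; congr (sin _ * sin _ + sin _ * sin _); field.
Qed.

End Angles.

(** * Unit complex numbers as exponentials of angles *)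

Section UnitCircle.
Variable R : realType.

Lemma expiD (x y : R) : expi (x + y) = expi x * expi y.
Proof. by rewrite /expi cosD sinD; apply/eqP; rewrite eq_complex /= eqxx addrC eqxx. Qed.

Lemma expi0 : expi (0 : R) = 1.
Proof. by rewrite /expi cos0 sin0. Qed.

Lemma norm_expi (x : R) : `|expi x| = 1.
Proof. by rewrite normc_def /= cos2Dsin2 sqrtr1. Qed.

Lemma expi_add_2pi (x : R) (i : nat) : expi (x + i%:R * (2 * pi)) = expi x.
Proof.
have -> : x + i%:R * (2 * pi) = x + (pi *+ 2) *+ i by rewrite -[in RHS]mulr_natl -(mulr_natl pi).
by rewrite /expi (periodicn (@cosD2pi R)) (periodicn (@sinD2pi R)).
Qed.

Lemma norm1_expi (u : R[i]) : `|u| = 1 -> exists2 t : R, `|t| <= pi & u = expi t.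
Proof.
move=> u1; have := add_Re2_Im2 u; rewrite u1 expr1n => /(congr1 (@complex.Re R)) /=.
case: u {u1} => a b /= ab1.
have a1 : -1 <= a <= 1.
  have := sqr_ge0 b => b2.
  by rewrite -ler_norml -(@ler_sqr R) ?nnegrE // real_normK ?num_real // expr1n; lra.
have sab : Num.sqrt (1 - a ^+ 2) = `|b|.
  by rewrite (_ : 1 - a ^+ 2 = b ^+ 2) ?sqrtr_sqr //; lra.
have p0 := acos_ge0 a1; have p1 := acos_lepi a1.
have [b0|b0] := lerP 0 b.
  exists (acos a); first by rewrite ger0_norm.
  by rewrite /expi acosK ?in_itv // sin_acos // sab ger0_norm.
exists (- acos a); first by rewrite normrN ger0_norm.
by rewrite /expi cosN sinN acosK ?in_itv // sin_acos // sab ltr0_norm // opprK.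
Qed.

End UnitCircle.

(** * Sorting the angles of the given points *)

Section SortedAngles.
Variables (R : realType) (N : nat) (z : 'I_N -> R[i]).

Lemma count_in_uniq (s : seq 'I_N) (A : set R[i]) :
  uniq s -> (forall j, j \in s -> A (z j)) -> (size s <= count_in z A)%N.
Proof.
move=> /card_uniqP <- sA; apply: subset_leq_card; apply/fintype.subsetP => j js.
by rewrite inE; exact: sA.
Qed.

(** Continuing the sorted angles by full turns lets arcs cross the cut at [pi]. If
    [theta (l + m) < theta l + L], some open arc of length [L] contains [m + 1] points, whose
    indices are distinct because [m < N]. *)
Lemma sorted_angles (hN : (0 < N)%N) (hz : forall j, `|z j| = 1) :
  exists theta : nat -> R, [/\
    `|\sum_(j < N) z j| = (\sum_(l < N) cos (theta l))%:C,
    forall l, theta (l + N)%N = theta l + 2 * pi,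
    forall l, theta l <= theta l.+1,
    forall l, (l < N)%N -> `|theta l| <= pi &
    forall (m : nat) (L : R), (m < N)%N ->
      (forall u : R[i], `|u| = 1 -> (count_in z (open_arc u L) <= m)%N) ->
      forall l, theta l + L <= theta (l + m)%N].
Proof.
set S := \sum_(j < N) z j.
have [b Sb] : exists b : R, S = `|S| * expi b.
  have [->|S0] := eqVneq S 0; first by exists 0; rewrite normr0 mul0r.
  have [|b _ hb] := @norm1_expi R (S / `|S|).
    by rewrite normrM normfV normr_id divff ?normr_eq0.
  by exists b; rewrite -hb mulrCA divff ?mulr1 ?normr_eq0.
have ebN : expi b * expi (- b) = 1 :> R[i] by rewrite -expiD subrr expi0.
have /choice[al hal] : forall j, exists t : R, `|t| <= pi /\ z j = expi b * expi t.
  move=> j; have [|t tpi zt] := @norm1_expi R (z j * expi (- b)).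
    by rewrite normrM hz norm_expi mulr1.
  by exists t; split=> //; rewrite -zt mulrCA ebN mulr1.
have al_pi j : `|al j| <= pi by have [] := hal j.
have zE j : z j = expi b * expi (al j) by have [] := hal j.
pose i0 := Ordinal hN.
pose s := sort (relpre al <=%R) (enum 'I_N).
have s_size : size s = N by rewrite size_sort size_enum_ord.
have s_uniq : uniq s by rewrite sort_uniq enum_uniq.
have s_sorted : sorted (relpre al <=%R) s.
  by apply: sort_sorted => i j; exact: le_total.
pose sg l := nth i0 s (l %% N)%N.
pose theta l := al (sg l) + (l %/ N)%:R * (2 * pi).
have pi0 := pi_gt0 R.
have zsg l : z (sg l) = expi b * expi (theta l) by rewrite expi_add_2pi zE.
have theta_small l : (l < N)%N -> theta l = al (nth i0 s l).
  by move=> lN; rewrite /theta /sg modn_small // divn_small // mul0r addr0.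
have mono l : theta l <= theta l.+1.
  rewrite /theta /sg; have := ltn_pmod l hN; set p := (l %% N)%N => pN.
  have [p1N|] := ltnP p.+1 N.
    have -> : (l.+1 %% N = p.+1)%N by rewrite -addn1 -modnDml addn1 -/p modn_small.
    have -> : (l.+1 %/ N = l %/ N)%N.
      by rewrite {1}(divn_eq l N) -/p -addnS divnMDl // (divn_small p1N) addn0.
    rewrite lerD2r; have /(sortedP i0) := s_sorted; apply; by rewrite s_size.
  rewrite leq_eqVlt ltnNge pN orbF => /eqP Np.
  have -> : (l.+1 %% N = 0)%N by rewrite -addn1 -modnDml addn1 -/p -Np modnn.
  have -> : (l.+1 %/ N = (l %/ N).+1)%N.
    by rewrite {1}(divn_eq l N) -addnS divnMDl // -/p -Np divnn hN addn1.
  have := al_pi (nth i0 s p); have := al_pi (nth i0 s 0%N).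
  by rewrite -natr1 !ler_norml; lra.
have monoW i j : (i <= j)%N -> theta i <= theta j.
  by move=> ij; rewrite -(subnK ij); elim: (j - i)%N => // m /le_trans; apply; exact: mono.
exists theta; split=> //.
(* After rotation by [- b] the sum is the real number [|S|], so taking real parts leaves the
   cosines. *)
- have normS : `|S| = \sum_(j < N) expi (al j).
    rewrite -[LHS]mulr1 -ebN mulrA -Sb /S mulr_suml.
    by apply: eq_bigr => j _; rewrite zE mulrAC ebN mul1r.
  have -> : \sum_(l < N) cos (theta l) = \sum_(j < N) cos (al j).
    under eq_bigr do rewrite theta_small //.
    have -> : \sum_(l < N) cos (al (nth i0 s l)) = \sum_(j <- s) cos (al j).
      by rewrite [RHS](big_nth i0) big_mkord s_size.
    by rewrite -[RHS]big_enum /=; apply: perm_big; rewrite perm_sort.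
  rewrite (_ : `|S| = (complex.Re `|S|)%:C); last by rewrite normc_def.
  rewrite normS; congr (_%:C).
  by elim/big_ind2: _ => // _ x _ y <- <-; case: x; case: y.
- by move=> l; rewrite /theta /sg modnDr divnDr // divnn hN addn1 -natr1; ring.
- by move=> l lN; rewrite theta_small.
move=> m L mN hL l; rewrite leNgt; apply/negP => lt_mL.
(* Half of the spare length: an arc starting [eta] before [theta l] has both [theta l] and
   [theta (l + m)] strictly inside. *)
pose eta := (theta l + L - theta (l + m)%N) / 2.
pose u := expi b * expi (theta l - eta).
have u1 : `|u| = 1 by rewrite normrM !norm_expi mulr1.
suff : (m.+1 <= count_in z (open_arc u L))%N by rewrite ltnNge hL.
have := @count_in_uniq [seq sg (l + i)%N | i <- iota 0 m.+1] (open_arc u L).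
rewrite size_map size_iota; apply.
  rewrite map_inj_in_uniq ?iota_uniq // => i j; rewrite !mem_iota !add0n /=.
  rewrite !ltnS => im jm /eqP.
  rewrite nth_uniq ?s_size ?ltn_pmod // eqn_modDl !modn_small; first by move/eqP.
  - exact: leq_ltn_trans mN.
  - exact: leq_ltn_trans mN.
move=> j /mapP[p]; rewrite mem_iota add0n /= ltnS => pm ->.
exists (theta (l + p)%N - theta l + eta).
  have := monoW l (l + p)%N (leq_addr _ _).
  have := monoW (l + p)%N (l + m)%N; rewrite leq_add2l => /(_ pm).
  by rewrite /= in_itv /= /eta; lra.
by rewrite zsg /u -mulrA -expiD; congr (_ * expi _); ring.
Qed.

End SortedAngles.

Theorem theorem4 (R : realType) (n N : nat) (delta phi : R) (z : 'I_N -> R[i])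
    (hn : (1 <= n)%N) (hN : (1 <= N)%N)
    (hdelta : 0 < delta <= pi) (hphi : 0 < phi <= pi)
    (hdeltaphi : n%:R * delta <= phi)
    (hz : forall j, `|z j| = 1)
    (hi : forall u : R[i], `|u| = 1 -> (count_in z (open_arc u phi) <= n)%N)
    (hii : forall u : R[i], `|u| = 1 -> (count_in z (open_arc u delta) <= 1)%N)
    (k : nat) (hk : (1 <= k)%N) (hkphi : k%:R <= 2 * pi / phi) :
  `|\sum_(j < N) z j| <=
    (sin ((N%:R - (k%:R - 1) * n%:R) * delta / 2) / sin (delta / 2)
       * (sin (k%:R * phi / 2) / sin (phi / 2))
     + sin ((k%:R * n%:R - N%:R) * delta / 2) / sin (delta / 2)
       * (sin ((k%:R - 1) * phi / 2) / sin (phi / 2)))%:C.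
Proof.
have [/andP[d0 dpi] /andP[phi0 phipi]] := (hdelta, hphi).
have pi0 := pi_gt0 R.
have sd : 0 < sin (delta / 2) by apply: sin_gt0_pi; lra.
have sp : 0 < sin (phi / 2) by apply: sin_gt0_pi; lra.
have [theta [-> per mono hpi sep]] := sorted_angles hN hz.
rewrite lecR.
(* Over the common positive denominator [sin (delta / 2) * sin (phi / 2)] the numerator is
   [arc_bound]. *)
rewrite mulrACA -invfM [X in _ + X]mulrACA -invfM -mulrDl.
rewrite ler_pdivlMr ?mulr_gt0 // [leLHS]mulrC -[leLHS]mulrA.
apply: sum_cos_angles_le => //.
- by rewrite -ler_pdivlMr.
- by move=> N1 l; rewrite -addn1; exact: sep.
- by move=> nN; exact: sep.
Qed.
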